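(* Let $n\ge 1$ and let $m$ be the integer such that $f_m\le n+1<f_{m+1}$. Then $$\sum_{i=f_m-1}^{n}a(i)=\begin{cases}\displaystyle\sum_{i=f_{m-2}-1}^{n-f_{m-1}}a(i)+n-f_m+2, & \text{if } n+1<2f_{m-1},\\[2ex] \displaystyle\sum_{i=f_{m-1}-1}^{n-f_{m-1}}a(i)+C(m-2)+n-f_m+2, & \text{otherwise.}\end{cases}$$
   Context: The Fibonacci sequence $\mathbb{F}$ is the infinite word over $\{a,b\}$ that is the fixed point beginning with $a$ of the morphism $\sigma(a)=ab$, $\sigma(b)=a$; positions are numbered from $1$, and $\mathbb{F}[1,n]$ is its prefix of length $n$. The numbers $f_m$ are given by $f_{-2}=0$, $f_{-1}=1$, $f_m=f_{m-1}+f_{m-2}$ for $m\ge 0$ (so $f_0=1,f_1=2,f_2=3$). $\mathcal{P}_F$ is the set of nonempty palindromes occurring as factors (finite contiguous subwords) of $\mathbb{F}$. For a factor $\omega$ and $p\ge1$, $\omega_p$ denotes the $p$-th occurrence of $\omega$ in $\mathbb{F}$. For $n\ge1$, $a(n)$ is the number of pairs $(\omega,p)$ with $\omega\in\mathcal{P}_F$, $p\ge1$, such that $\omega_p$ ends exactly at position $n$ (i.e. is a suffix of $\mathbb{F}[1,n]$); set $a(0)=0$. Put $A(n)=\sum_{i=1}^{n}a(i)$ (with $A(0)=0$), which is the number of pairs $(\omega,p)$ with $\omega\in\mathcal{P}_F$ and $\omega_p$ contained in $\mathbb{F}[1,n]$. For $k\ge1$, $C(k)=A(f_{k+1}-2)-A(f_k-2)$,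 and $C(0)=C(-1)=0$. *)

(* Defs.v *)
From HB Require Import structures.
From mathcomp Require Import all_boot all_order all_algebra.
From mathcomp Require Import finmap.
From mathcomp Require Import boolp classical_sets functions cardinality.

Set Implicit Arguments.
Unset Strict Implicit.
Unset Printing Implicit Defensive.

Import Order.TTheory GRing.Theory Num.Theory.

Inductive letter := la | lb.

Definition bool_of_letter (x : letter) : bool := if x is la then true else false.
Definition letter_of_bool (b : bool) : letter := if b then la else lb.
Fact bool_of_letterK : cancel bool_of_letter letter_of_bool.
Proof. by case. Qed.
HB.instance Definition _ := Equality.copy letter (can_type bool_of_letterK).
HB.instance Definition _ := Choice.copy letter (can_type bool_of_letterK).
HB.instance Definition _ := Countable.copy letter (can_type bool_of_letterK).

Definition word := seq letter.

Definition sigma1 (x : letter) : word :=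
  match x with la => [:: la; lb] | lb => [:: la] end.
Definition sigma (w : word) : word := flatten (map sigma1 w).

(* The Fibonacci word, the limit of the words sigma^k(a).  The letter at
   position i >= 1 is read off sigma^i(a), which has more than i letters; the
   value at i = 0 is meaningless.  That this is the unique fixed point of sigma
   beginning with a is [Fib_fixed] and [Fib_unique] below. *)
Definition Fib (i : nat) : letter := nth la (iter i sigma [:: la]) i.-1.

(* G[i], ..., G[i + l - 1] *)
Definition factor (G : nat -> letter) (i l : nat) : word :=
  [seq G j | j <- iota i l].

Lemma sigma_cat u v : sigma (u ++ v) = sigma u ++ sigma v.
Proof. by rewrite /sigma map_cat flatten_cat. Qed.

Lemma sigma_prefix u v : prefix u v -> prefix (sigma u) (sigma v).
Proof. by case/prefixP=> w ->; rewrite sigma_cat prefix_prefix. Qed.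

Lemma iter_sigma_prefix k l : k <= l ->
  prefix (iter k sigma [:: la]) (iter l sigma [:: la]).
Proof.
have step j : prefix (iter j sigma [:: la]) (iter j.+1 sigma [:: la]).
  by elim: j => // j IH; rewrite iterS [X in prefix _ X]iterS sigma_prefix.
move=> /subnKC <-; elim: (l - k) => [|j IH]; first by rewrite addn0 prefix_refl.
by rewrite addnS; apply: prefix_trans IH (step _).
Qed.

Lemma size_sigma w : size (sigma w) = size w + count (pred1 la) w.
Proof.
elim: w => //= x w; rewrite /sigma /= size_cat => ->.
by case: x => /=; rewrite ?add0n ?add1n ?add2n ?addSn ?addnS.
Qed.

Lemma size_iter_sigma k : k < size (iter k sigma [:: la]).
Proof.
elim: k => // k IH; rewrite iterS size_sigma -addn1 leq_add //.
rewrite -has_count; apply/hasP; exists la => //.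
by have /prefixP[s ->] := iter_sigma_prefix (leq0n k); rewrite mem_head.
Qed.

Lemma factor_prefix (G : nat -> letter) n : size (factor G 1 n) = n.
Proof. by rewrite size_map size_iota. Qed.

Lemma Fib_prefix n k : n <= size (iter k sigma [:: la]) ->
  factor Fib 1 n = take n (iter k sigma [:: la]).
Proof.
move=> nk; apply: (@eq_from_nth _ la); first by rewrite factor_prefix size_takel.
move=> i; rewrite factor_prefix => ltin.
rewrite (nth_map 0) ?size_iota // nth_iota // add1n nth_take // /Fib.
have lei := ltnW (size_iter_sigma i.+1); have ltk := leq_trans ltin nk.
have [ik|/ltnW ki] := leqP i.+1 k.
  by have /prefixP[s ->] := iter_sigma_prefix ik; rewrite nth_cat lei.
by have /prefixP[s ->] := iter_sigma_prefix ki; rewrite nth_cat ltk.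
Qed.

(* G = sigma(G), expressed on the prefixes of G *)
Definition sigma_fixed (G : nat -> letter) : Prop :=
  forall n, sigma (factor G 1 n) = factor G 1 (size (sigma (factor G 1 n))).

Lemma Fib_fixed : Fib 1 = la /\ sigma_fixed Fib.
Proof.
split=> // n; have lt_n := ltnW (size_iter_sigma n).
have pf : prefix (sigma (factor Fib 1 n)) (iter n.+1 sigma [:: la]).
  by rewrite iterS sigma_prefix // (Fib_prefix lt_n) prefix_take.
rewrite [in RHS](@Fib_prefix _ n.+1) ?size_prefix //.
by apply/esym/eqP; rewrite -prefixE.
Qed.

Lemma Fib_unique (G : nat -> letter) : G 1 = la -> sigma_fixed G ->
  forall i, 0 < i -> G i = Fib i.
Proof.
move=> G1 fixG.
have H k : factor G 1 (size (iter k sigma [:: la])) = iter k sigma [:: la].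
  elim: k => [|k IH]; first by rewrite /factor /= G1.
  by have := fixG (size (iter k sigma [:: la])); rewrite IH -iterS => <-.
move=> [//|i] _; rewrite /Fib -[in RHS]H.
have lti := ltnW (size_iter_sigma i.+1).
by rewrite (nth_map 0) ?size_iota // nth_iota.
Qed.

Definition occurs_at (w : word) (i : nat) : bool :=
  (0 < i) && (factor Fib i (size w) == w).

(* The p-th occurrence of w (p >= 1) starts at position i. *)
Definition nth_occurrence (w : word) (p i : nat) : Prop :=
  [/\ 0 < p, occurs_at w i & count (occurs_at w) (iota 1 i) = p].

Definition palindrome (w : word) : bool := rev w == w.

Local Open Scope classical_set_scope.

Definition PalF : set word :=
  [set w | [/\ w != [::], palindrome w & exists i, occurs_at w i]].

(* The pairs (w, p) such that the p-th occurrence of the palindrome w ends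
   exactly at position n *)
Definition pal_ending (n : nat) : set (word * nat) :=
  [set wp | PalF wp.1 /\
     exists2 i, nth_occurrence wp.1 wp.2 i & i + size wp.1 = n.+1].

(* so that the cardinal in [a_] is a genuine one *)
Lemma finite_pal_ending n : finite_set (pal_ending n).
Proof.
pose g l := (factor Fib (n.+1 - l) l,
             count (occurs_at (factor Fib (n.+1 - l) l)) (iota 1 (n.+1 - l))).
apply: (@sub_finite_set _ _ (g @` `I_n.+2)); last exact/finite_image/finite_II.
move=> [w p] [_ [i [/= _ /andP[_ /eqP Ew] <-] En]].
exists (size w); first by rewrite /= ltnS -En leq_addl.
by rewrite /g -En addnK Ew.
Qed.

Definition a_ (n : nat) : nat :=
  if n == 0 then 0 else #|` fset_set (pal_ending n)|%fset.

Definition A_ (n : nat) : nat := \sum_(1 <= i < n.+1) a_ i.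

Fixpoint fibonacci (n : nat) : nat :=
  match n with
  | 0 => 0
  | 1 => 1
  | (k.+1 as k1).+1 => fibonacci k1 + fibonacci k
  end.

(* f_m, meaningful for m >= -2 only *)
Definition f_ (m : int) : nat := fibonacci `|(m + 2)%R|%N.

Lemma f_m2 : f_ (- 2%:Z)%R = 0. Proof. by []. Qed.
Lemma f_m1 : f_ (- 1%:Z)%R = 1. Proof. by []. Qed.
Lemma f_rec (m : int) : (0 <= m)%R -> f_ m = f_ (m - 1)%R + f_ (m - 2)%R.
Proof.
case: m => // m _; rewrite /f_ subrK.
have -> : (m%:Z - 1 + 2 = m.+1%:Z)%R by rewrite -addrA -[m.+1]addn1 PoszD.
by rewrite -PoszD !absz_nat addn2.
Qed.

(* C(k), meaningful for k >= -1 only.  The natural-number subtraction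
   f_k - 2 is exact, as f_k >= 2 for k >= 1. *)
Definition C_ (k : int) : int :=
  if (1 <= k)%R then ((A_ (f_ (k + 1)%R - 2))%:Z - (A_ (f_ k - 2))%:Z)%R else 0%R.

(* Main.v *)
(** Let f_m <= n + 1 < f_(m+1), p = f_(m-1) and r = f_(m-2).  Everything follows
from a(n) = a(n - p) + 1.  The prefix of length f_(m+1) - 2 of the Fibonacci
word is a palindrome with period p, hence F[1, n - p] is also a suffix of F[1, n]
and the palindromic suffixes of length at most n - p are the same for both
prefixes.  It remains to see that exactly one palindromic suffix of F[1, n]
starts at a position <= p.  The mirror symmetry of the p-periodic extension x
of F[1, p] gives one.  A palindrome starting at another such position would,
composed with this symmetry, make a shift of x by a non-multiple of p fix the
window of length r starting at position p; but this window contains a different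
number of letters a than all the other windows of length r in a period. *)
Require Import Defs.
From mathcomp Require Import all_boot all_order all_algebra.
From mathcomp Require Import finmap classical_sets cardinality zify.

Import Order.TTheory GRing.Theory Num.Theory.

(* The Fibonacci word with positions numbered from 0. *)
Local Notation F0 i := (Fib i.+1).

(** * Fibonacci numbers and the words [iter k sigma [:: la]] *)

Lemma fibonacciSS k : fibonacci k.+2 = fibonacci k.+1 + fibonacci k.
Proof. by []. Qed.

Lemma fibonacci_gt0 k : 0 < fibonacci k.+1.
Proof. by elim: k => // k IH; rewrite fibonacciSS addn_gt0 IH. Qed.

Lemma leq_fibonacciS k : fibonacci k <= fibonacci k.+1.
Proof. by case: k => // k; rewrite fibonacciSS leq_addr. Qed.

Lemma iter_sigmaSS k : iter k.+2 sigma [:: la] =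
  iter k.+1 sigma [:: la] ++ iter k sigma [:: la].
Proof. by elim: k => // k IH; rewrite [LHS]iterS {1}IH sigma_cat. Qed.

Lemma size_iter_sigma_fibonacci k :
  size (iter k sigma [:: la]) = fibonacci k.+2.
Proof.
suff: size (iter k sigma [:: la]) = fibonacci k.+2 /\
      size (iter k.+1 sigma [:: la]) = fibonacci k.+3 by case.
by elim: k => // k [IH IH1]; rewrite iter_sigmaSS size_cat IH IH1.
Qed.

Lemma Fib_nth_iter k i : i < fibonacci k.+2 ->
  F0 i = nth la (iter k sigma [:: la]) i.
Proof.
move=> lt_i; have := @Fib_prefix i.+1 k; rewrite size_iter_sigma_fibonacci.
move/(_ lt_i)/(congr1 (fun s => nth la s i)); rewrite nth_take // => <-.
by rewrite (nth_map 0) ?size_iota // nth_iota.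
Qed.

(** * Periods and mirror symmetry of the Fibonacci word *)

Lemma Fib_addl k i : i < fibonacci k.+2 -> F0 (fibonacci k.+3 + i) = F0 i.
Proof.
move=> lt_i; rewrite (@Fib_nth_iter k.+2); last by rewrite fibonacciSS ltn_add2l.
rewrite iter_sigmaSS nth_cat size_iter_sigma_fibonacci ltnNge leq_addr /=.
by rewrite addKn -Fib_nth_iter.
Qed.

Lemma Fib_period k i : i < fibonacci k.+2 - 2 ->
  F0 (fibonacci k.+1 + i) = F0 i.
Proof.
elim: k i => [|[|k] IH] i lt_i //.
have [i_small|i_large] := ltnP i (fibonacci k.+2); first exact: Fib_addl.
have E3 := fibonacciSS k.+1; have E4 := fibonacciSS k.+2.
(* Now [fibonacci k.+3 + i] is [fibonacci k.+4 + j], so both sides reduce to [F0 j]. *)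
have [j Ei] : exists j, i = fibonacci k.+2 + j.
  by exists (i - fibonacci k.+2); rewrite subnKC.
rewrite {1}Ei addnA -fibonacciSS Fib_addl; last by lia.
by rewrite Ei IH //; lia.
Qed.

(** Consecutive words [sigma^k(a)] end in ab and ba by turns, since [sigma^(k+2)(a)] ends in
    [sigma^k(a)]. *)
Lemma Fib_last_two k :
  F0 (fibonacci k.+4 - 1) = F0 (fibonacci k.+3 - 2) /\
  F0 (fibonacci k.+4 - 2) = F0 (fibonacci k.+3 - 1).
Proof.
elim: k => // k [IH1 IH2]; have gt0 := fibonacci_gt0 k.
have E3 := fibonacciSS k.+1; have E4 := fibonacciSS k.+2.
have E5 := fibonacciSS k.+3; have E2 := fibonacciSS k.
have le := leq_fibonacciS k.
have -> : fibonacci k.+4.+1 - 1 = fibonacci k.+4 + (fibonacci k.+3 - 1) by lia.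
have -> : fibonacci k.+4.+1 - 2 = fibonacci k.+4 + (fibonacci k.+3 - 2) by lia.
by rewrite !Fib_addl; [split|lia|lia].
Qed.

Lemma Fib_last_neq k :
  F0 (fibonacci k.+3 - 1) <> F0 (fibonacci k.+2 - 1).
Proof.
elim: k => // k IH E; apply: IH; rewrite -E; have gt0 := fibonacci_gt0 k.+1.
have E4 := fibonacciSS k.+2.
have -> : fibonacci k.+4 - 1 = fibonacci k.+3 + (fibonacci k.+2 - 1) by lia.
by rewrite Fib_addl //; lia.
Qed.

(** Induction on two consecutive [k]: [Fib_addl] or [Fib_period] lowers [j] by a Fibonacci number,
    except for two pairs that [Fib_last_two] settles. *)
Lemma Fib_mirror k i j : i + j + 3 = fibonacci k -> F0 i = F0 j.
Proof.
move: i j; suff: (forall i j, i + j + 3 = fibonacci k -> F0 i = F0 j) /\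
  (forall i j, i + j + 3 = fibonacci k.+1 -> F0 i = F0 j) by case.
elim: k => [|k [IH1 IH2]]; first by split=> i j /=; lia.
split=> //; move=> i j.
wlog le_ij: i j / i <= j => [hw|].
  move=> E; case/orP: (leq_total i j) => le; first exact: hw.
  by apply/esym/hw; rewrite // [j + i]addnC.
case: k IH1 IH2 => [|[|k]] IH1 IH2; [by move=> /= ?; lia | by move=> /= ?; lia |].
have gt0 := fibonacci_gt0 k; have E2 := fibonacciSS k.
have E3 := fibonacciSS k.+1; have E4 := fibonacciSS k.+2.
have le := leq_fibonacciS k.
rewrite E4 => E.
have [j_large|j_small] := leqP (fibonacci k.+3) j.
  have Ej : j = fibonacci k.+3 + (j - fibonacci k.+3) by lia.
  by rewrite Ej Fib_addl; [apply: IH1; lia | lia].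
have [i_large|i_small] := leqP (fibonacci k.+2) i.
  have Ej : j = fibonacci k.+2 + (j - fibonacci k.+2) by lia.
  by rewrite Ej Fib_period; [apply: IH2; lia | lia].
case: k IH1 IH2 gt0 E2 E3 E4 le E j_small i_small =>
  [|k] IH1 IH2 gt0 E2 E3 E4 le E j_small i_small.
  move: E i_small j_small => /=; case: i le_ij => [|i];
    by case: j => [|[|j]] //=; lia.
have [L1 L2] := Fib_last_two k; have gt0' := fibonacci_gt0 k.
have [Ei|Ei] : i = fibonacci k.+3 - 1 \/ i = fibonacci k.+3 - 2 by lia.
  by rewrite Ei -L2; congr Fib; lia.
by rewrite Ei -L1; congr Fib; lia.
Qed.

(** * Palindromic suffixes of prefixes, and letter counts in windows *)

Lemma size_factor G i l : size (factor G i l) = l.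
Proof. by rewrite size_map size_iota. Qed.

Lemma nth_factor G i l j : j < l -> nth la (factor G i l) j = G (i + j).
Proof. by move=> lt_j; rewrite (nth_map 0) ?size_iota // nth_iota. Qed.

Lemma palindrome_factorP n t : t < n ->
  reflect (forall i, t <= i < n -> F0 i = F0 (t + n - i.+1))
          (palindrome (factor Fib t.+1 (n - t))).
Proof.
move=> lt_tn; apply: (iffP eqP) => [E i /andP[ti ltin]|E].
  have := congr1 (fun s => nth la s (i - t)) E.
  rewrite nth_rev ?size_factor ?nth_factor; [|lia..].
  have -> : (t.+1 + (i - t) = i.+1)%N by lia.
  by move=> <-; congr Fib; lia.
apply: (@eq_from_nth _ la); rewrite size_rev // => i; rewrite size_factor => lti.
rewrite nth_rev ?size_factor // !nth_factor; [|lia..].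
by rewrite addSn E; [congr Fib|]; lia.
Qed.

(** A pair ending at [n] is determined by the length of its word, its index being the count of
    occurrences so far. *)
Lemma a_count n :
  a_ n = count (fun l => palindrome (factor Fib (n.+1 - l) l)) (iota 1 n).
Proof.
rewrite /a_; case: eqP => [-> //|_].
set P := (X in count X _).
pose g l := (factor Fib (n.+1 - l) l,
             count (occurs_at (factor Fib (n.+1 - l) l)) (iota 1 (n.+1 - l))).
have -> : pal_ending n = [set` map g (filter P (iota 1 n))]%classic.
  apply/seteqP; split=> [[w p]|[w p]] /=.
    move=> [[/= w0 palw _] [i [/= p0 /andP[i0 /eqP Ew] Ep] /= En]].
    apply/mapP; exists (size w); last by rewrite /g -En addnK Ew Ep.
    rewrite mem_filter /P -En addnK Ew palw mem_iota.
    by rewrite lt0n size_eq0 w0 /=; lia.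
  move/mapP=> [l]; rewrite mem_filter mem_iota /P => /andP[Pl /andP[l0 ln]] [-> ->].
  have occ : occurs_at (factor Fib (n.+1 - l) l) (n.+1 - l).
    by rewrite /occurs_at size_factor eqxx andbT; lia.
  split=> /=; first split=> //.
  - by rewrite -size_eq0 size_factor; lia.
  - by exists (n.+1 - l).
  exists (n.+1 - l); last by rewrite size_factor; lia.
  split=> //=; rewrite -has_count; apply/hasP; exists (n.+1 - l) => //.
  by rewrite mem_iota; lia.
have uniq_s : uniq (map g (filter P (iota 1 n))).
  rewrite map_inj_in_uniq ?filter_uniq ?iota_uniq // => l l' _ _.
  by move/(congr1 (fun wp => size wp.1)); rewrite /= !size_factor.
rewrite -size_filter -(size_map g) -[in RHS](undup_id uniq_s) -card_fseq.
congr (#|` _|)%fset; apply/fsetP=> x; rewrite in_fset_set //=.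
rewrite [in RHS]inE.
by apply/idP/idP => [/set_mem //|?]; apply/mem_set.
Qed.

(* The number N i of letters a in the window [i, i + r) is constant on
   0 <= i <= p - 2, as x i = x (i + r) there, and it differs at i = p - 1. *)
Lemma window_unique (x : nat -> letter) p r e :
    (forall i, x (i + p) = x i) ->
    (forall i, i + 2 < p -> x (i + r) = x i) ->
    1 < p -> x (p.-1 + r) <> x p.-1 ->
    (forall j, j < r -> x (p.-1 + j) = x (p.-1 + j + e)) -> p %| e.
Proof.
move=> per per_r p_gt1 neq match_e.
pose N i := \sum_(0 <= j < r) (x (i + j) == la).
have NS i : N i.+1 + (x i == la) = N i + (x (i + r) == la).
  rewrite /N -big_nat_recr //= [RHS]big_nat_recl // addn0 addnC.
  by congr (_ + _); apply: eq_bigr => j _; rewrite addSnnS.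
have Nper i : N (i + p) = N i.
  by apply: eq_bigr => j _; rewrite addnAC per.
have NperM i c : N (i + c * p) = N i.
  by elim: c => [|c IH]; rewrite ?addn0 // mulSn addnCA addnC Nper.
have N0 i : i + 1 < p -> N i = N 0.
  elim: i => // i IH lt_i; rewrite -IH; last by lia.
  by have := NS i; rewrite per_r; [lia | lia].
have Np : N p.-1 <> N 0.
  (* Sliding the window from [p.-1] to [p] trades two distinct letters, and [N p = N 0]. *)
  move=> E; have := NS p.-1; rewrite prednK; last by lia.
  rewrite -[p]add0n Nper -E add0n => /addnI; move: neq.
  by case: (x p.-1); case: (x _).
have : N p.-1 = N (p.-1 + e).
  by apply: eq_big_nat => j ltj; rewrite match_e // addnAC.
rewrite [in RHS](divn_eq (p.-1 + e) p) addnC NperM => E.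
have lt_mod : (p.-1 + e) %% p < p by rewrite ltn_mod; lia.
have [lt1|ge1] := ltnP ((p.-1 + e) %% p + 1) p; first by case: Np; rewrite E N0.
have Em : (p.-1 + e) %% p = p.-1 by lia.
rewrite /dvdn; have := eqn_modDl p.-1 e 0 p.
by rewrite addn0 mod0n Em modn_small ?eqxx; last lia; move=> <-.
Qed.

(** * The recursion for [a_] *)

Lemma a_rec k n : fibonacci k.+3 <= n + 1 < fibonacci k.+4 ->
  a_ n = (a_ (n - fibonacci k.+2)).+1.
Proof.
set p := fibonacci k.+2; set r := fibonacci k.+1.
have E3 : fibonacci k.+3 = p + r by [].
have E4 : fibonacci k.+4 = p + r + p by [].
have p_gt0 : 0 < p := fibonacci_gt0 _; have r_gt0 : 0 < r := fibonacci_gt0 _.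
have le_rp : r <= p := leq_fibonacciS _.
move=> /andP[]; rewrite E3 E4 => n_ge n_lt.
(* Here [n <= L], and the prefix of length [L] is a palindrome with period [p]. *)
have [L LE] : exists L, L = p + r + p - 2 by eexists.
have perF i : i + p < L -> F0 (i + p) = F0 i.
  by move=> lt_i; rewrite addnC Fib_period // E3; lia.
have mirF i : i < L -> F0 i = F0 (L - i.+1).
  by move=> lt_i; apply: (@Fib_mirror k.+4); rewrite E4; lia.
pose x i := F0 (i %% p).
have perx i : x (i + p) = x i by rewrite /x modnDr.
have xE i : i < L -> F0 i = x i.
  elim/ltn_ind: i => i IH lt_i; have [lt_ip|le_pi] := ltnP i p.
    by rewrite /x modn_small.
  by rewrite -(subnK le_pi) perx perF ?IH ?subnK //; lia.
rewrite !a_count.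
have -> : iota 1 n = iota 1 (n - p) ++ iota (n - p).+1 p.
  by rewrite -[in LHS](@subnK p n) ?iotaD ?add1n //; lia.
(* The lengths [l > n - p] correspond to the starts [t = n - l < p]. *)
rewrite count_cat -[RHS]addn1; congr (_ + _).
  apply: eq_in_count => l; rewrite mem_iota => /andP[l0 ln]; congr palindrome.
  apply: (@eq_from_nth _ la); rewrite !size_factor // => i lt_i.
  rewrite !nth_factor //.
  have -> : n.+1 - l + i = (n - p - l + i + p).+1 by lia.
  by rewrite perF; [congr Fib|]; lia.
(* Modulo [p], the reflection [i |-> t + n - 1 - i] agrees with the mirror [i |-> L - 1 - i] for
   this start [t < p] only. *)
pose t0 := (L - n) %% p.
have lt_t0 : t0 < p by rewrite ltn_mod.
have P0 : palindrome (factor Fib t0.+1 (n - t0)).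
  apply/palindrome_factorP; first by lia.
  move=> i /andP[le_i lt_i]; rewrite mirF ?xE; [|lia..].
  have -> : L - i.+1 = (L - n) %/ p * p + (t0 + n - i.+1).
    by have := divn_eq (L - n) p; rewrite -/t0; lia.
  by rewrite /x modnMDl.
have uniq_t t : t < p -> palindrome (factor Fib t.+1 (n - t)) -> t = t0.
  move=> lt_t /palindrome_factorP.
  have lt_tn : t < n by lia.
  move=> /(_ lt_tn) Pt.
  have [p1|p_gt1] := leqP p 1; first by lia.
  (* Reflection followed by mirror is the shift by [L - n - t]; adding [p] keeps the subtraction
     exact. The window [[p - 1, p - 1 + r)] lies in [[t, n)] for every [t < p]. *)
  have : p %| L - n + p - t.
    apply: (@window_unique x p r) => //.
    - move=> i lt_i; rewrite -!xE; [|lia..].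
      by rewrite addnC Fib_period //; lia.
    (* Modulo [p], the two positions are the last ones of consecutive words [sigma^k(a)]. *)
    - have -> : p.-1 + r = r.-1 + p by lia.
      rewrite perx -!xE; [|lia..].
      move: p_gt1; rewrite /r /p -!subn1; case: (k) => // k' _.
      exact/nesym/Fib_last_neq.
    move=> j lt_j; rewrite -[LHS]xE; last by lia.
    rewrite Pt; last by lia.
    rewrite mirF; last by lia.
    rewrite xE; last by lia.
    rewrite -perx; congr x; lia.
  move=> dvd_e; have /eqP : L - n + p = t %[mod p].
    by apply/eqP; rewrite eqn_mod_dvd //; lia.
  by rewrite modnDr -/t0 (modn_small lt_t) => /eqP.
rewrite (@eq_in_count _ _ (pred1 (n - t0))) => [|l].
  by rewrite count_uniq_mem ?iota_uniq // mem_iota; lia.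
rewrite mem_iota => /andP[l_ge l_lt] /=; apply/idP/eqP => [Pl|->].
  suff : n - l = t0 by lia.
  apply: uniq_t; first by lia.
  have -> : n - (n - l) = l by lia.
  by have -> : (n - l).+1 = n.+1 - l by lia.
by have -> : n.+1 - (n - t0) = t0.+1 by lia.
Qed.

(** * Summing the recursion *)

Lemma sum_addn1 (F : nat -> nat) m n :
  \sum_(m <= i < n) (F i + 1) = \sum_(m <= i < n) F i + (n - m).
Proof. by rewrite big_split /= sum_nat_const_nat muln1. Qed.

Lemma sum_nat_cat (F : nat -> nat) n m p : m <= n -> n <= p ->
  \sum_(m <= i < p) F i = \sum_(m <= i < n) F i + \sum_(n <= i < p) F i.
Proof. exact: big_cat_nat. Qed.

Lemma sum_a_rec k n : fibonacci k.+3 <= n + 1 < fibonacci k.+4 ->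
  \sum_(fibonacci k.+3 - 1 <= i < n.+1) a_ i + fibonacci k.+3 =
  \sum_(fibonacci k.+1 - 1 <= i < (n - fibonacci k.+2).+1) a_ i + n + 2.
Proof.
move=> /andP[n_ge n_lt]; have r_gt0 := fibonacci_gt0 k.
have E3 := fibonacciSS k.+1.
have -> : fibonacci k.+3 - 1 = fibonacci k.+1 - 1 + fibonacci k.+2 by lia.
rewrite big_addn (_ : n.+1 - _ = (n - fibonacci k.+2).+1); last by lia.
rewrite (@eq_big_nat _ _ _ _ _ _ (fun i => a_ i + 1)) => [|i lt_i].
  by rewrite sum_addn1; lia.
by rewrite (@a_rec k) ?addnK ?addn1 //; lia.
Qed.

Local Open Scope ring_scope.

Lemma f_fibonacci z j : z + 2 = Posz j -> f_ z = fibonacci j.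
Proof. by move=> E; rewrite /f_ E absz_nat. Qed.

(** With [m = k + 1], this block of [a_] separates the lower bounds in the two cases of the theorem.
    The defaults at -1 and 0 fit: the range is empty, or it is the single term [a_ 0 = 0]. *)
Lemma C_sum k : C_ (k%:Z - 1) =
  (\sum_(fibonacci k.+1 - 1 <= i < fibonacci k.+2 - 1) a_ i)%N%:Z.
Proof.
case: k => [|[|k]]; rewrite /C_.
- by rewrite big_geq.
- by rewrite big_nat1 /a_.
have -> : 1 <= (k.+2)%:Z - 1 by lia.
rewrite (@f_fibonacci (k.+2%:Z - 1) k.+3) ?(@f_fibonacci _ k.+4); [|lia..].
have gt0 := fibonacci_gt0 k; have gt1 := fibonacci_gt0 k.+1.
have E3 := fibonacciSS k.+1; have E4 := fibonacciSS k.+2.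
rewrite /A_ (_ : (fibonacci k.+4 - 2).+1 = (fibonacci k.+4 - 1)%N); last by lia.
rewrite (_ : (fibonacci k.+3 - 2).+1 = (fibonacci k.+3 - 1)%N); last by lia.
by rewrite [in LHS](@sum_nat_cat _ (fibonacci k.+3 - 1)); lia.
Qed.

(* The hypotheses force m >= 1, and all the natural-number subtractions in the
   bounds of the sums are then exact. *)
Theorem corollary4p5 (n : nat) (m : int) (n_ge1 : (1 <= n)%N)
    (m_ge : - 2 <= m) (m_n : (f_ m <= n + 1 < f_ (m + 1))%N) :
  (\sum_(f_ m - 1 <= i < n.+1) a_ i)%N%:Z =
  if (n + 1 < 2 * f_ (m - 1))%N then
    (\sum_(f_ (m - 2) - 1 <= i < (n - f_ (m - 1)).+1) a_ i)%N%:Z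
      + n%:Z - (f_ m)%:Z + 2
  else
    (\sum_(f_ (m - 1) - 1 <= i < (n - f_ (m - 1)).+1) a_ i)%N%:Z
      + C_ (m - 2) + n%:Z - (f_ m)%:Z + 2.
Proof.
have [k Em] : exists k : nat, m = k%:Z + 1.
  case: m m_ge m_n => [[|k]|[|[|k]]] //= _ m_n.
  - by move: m_n; rewrite /f_ /=; lia.
  - by exists k; lia.
  - by move: m_n; rewrite /f_ /=; lia.
  - by move: m_n; rewrite /f_ /=; lia.
subst m; move: m_n; rewrite !(@f_fibonacci (k%:Z + 1) k.+3); last by lia.
rewrite (@f_fibonacci _ k.+4); last by lia.
rewrite (@f_fibonacci (k%:Z + 1 - 1) k.+2); last by lia.
rewrite (@f_fibonacci (k%:Z + 1 - 2) k.+1); last by lia.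
move=> m_n; have sum_rec := @sum_a_rec k n m_n; case: ltnP => n_cmp; first by lia.
rewrite (_ : k%:Z + 1 - 2 = k%:Z - 1) ?C_sum; last by lia.
have E3 := fibonacciSS k.+1; have le := leq_fibonacciS k.+1.
(* As [2 * f_(m-1) <= n + 1], the sum can be cut at [f_(m-1) - 1]; its first piece is
   [C_ (m - 2)]. *)
by rewrite (@sum_nat_cat _ (fibonacci k.+2 - 1) (fibonacci k.+1 - 1)) in sum_rec; lia.
Qed.
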